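(* For every oval $\gamma$, the set of $3$-periodic points of its outer length billiard map $T$, $\{M: T^3(M)=M\}$, has empty interior in the exterior of $\gamma$. Likewise, the set of $4$-periodic points, $\{M: T^4(M)=M\}$, has empty interior.
   Context: Let $\gamma$ be an oval: a smooth closed curve in $\mathbb R^2$ with everywhere positive curvature, oriented counterclockwise. Its support function is a smooth $2\pi$-periodic $p$ with $p+p''>0$. $L(\alpha)=\{x\cos\alpha+y\sin\alpha=p(\alpha)\}$ is the tangent line with outer normal $(\cos\alpha,\sin\alpha)$, touching $\gamma$ at $\gamma(\alpha)=p(\alpha)(\cos\alpha,\sin\alpha)+p'(\alpha)(-\sin\alpha,\cos\alpha)$. Every point exterior to $\gamma$ is $M=L(\alpha_1)\cap L(\alpha_2)$ with $\alpha_1<\alpha_2<\alpha_1+\pi$. The outer length billiard map is $T(M)=L(\alpha_2)\cap L(\alpha_3)$, where $\alpha_3\in(\alpha_2,\alpha_2+\pi)$ is defined as follows. Let $K$ be the circle tangent to $L(\alpha_2)$ at $\gamma(\alpha_2)$, lying on the side of $L(\alpha_2)$ not containing $\gamma$, and tangent to $L(\alpha_1)$. Then $L(\alpha_3)$ is the common tangent line of $\gamma$ and $K$, other than $L(\alpha_1)$ and $L(\alpha_2)$, that leaves $\gamma$ and $K$ on the same side. *)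

(* Defs.v *)
From Stdlib Require Import Reals Lra.
From Coquelicot Require Import Coquelicot.
Open Scope R_scope.

Definition pt := (R * R)%type.

Definition dot (u v : pt) : R := fst u * fst v + snd u * snd v.

Definition nrm (a : R) : pt := (cos a, sin a).

(* An oval given by its support function p : smooth (C^infinity),
   2*PI-periodic, with p + p'' > 0. *)
Definition is_support_fn (p : R -> R) : Prop :=
  (forall (n : nat) (x : R), ex_derive (Derive_n p n) x) /\
  (forall x, p (x + 2 * PI) = p x) /\
  (forall x, p x + Derive_n p 2 x > 0).

Definition tline (p : R -> R) (a : R) : pt -> Prop :=
  fun X => dot X (nrm a) = p a.

(* tangency point gamma(a) = p(a)(cos a, sin a) + p'(a)(-sin a, cos a) *)
Definition gam (p : R -> R) (a : R) : pt :=
  (p a * cos a - Derive p a * sin a, p a * sin a + Derive p a * cos a).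

Definition inside_oval (p : R -> R) (X : pt) : Prop :=
  forall a, dot X (nrm a) <= p a.

Definition exterior (p : R -> R) (X : pt) : Prop := ~ inside_oval p X.

(* Outer length billiard map, as a relation: outer_T p M M' means M' = T(M).
   M = L(a1) /\ L(a2) with a1 < a2 < a1 + PI; K is the circle with center C
   and radius r > 0, tangent to L(a2) at gam a2 on the side not containing
   the oval (C = gam a2 + r (cos a2, sin a2)) and tangent to L(a1)
   (distance from C to L(a1) is r); L(a3), a3 in (a2, a2 + PI), is a
   common tangent line of the oval and K, different from L(a1) and L(a2),
   leaving K on the same side as the oval ({X | X.n(a3) <= p a3});
   then M' = L(a2) /\ L(a3). *)
Definition outer_T (p : R -> R) (M M' : pt) : Prop :=
  exists (a1 a2 a3 r : R) (C : pt),
    a1 < a2 < a1 + PI /\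
    tline p a1 M /\ tline p a2 M /\
    0 < r /\
    C = (fst (gam p a2) + r * cos a2, snd (gam p a2) + r * sin a2) /\
    Rabs (dot C (nrm a1) - p a1) = r /\
    a2 < a3 < a2 + PI /\
    tline p a3 <> tline p a1 /\ tline p a3 <> tline p a2 /\
    Rabs (dot C (nrm a3) - p a3) = r /\
    dot C (nrm a3) < p a3 /\
    tline p a2 M' /\ tline p a3 M'.

Fixpoint outer_T_iter (p : R -> R) (n : nat) (M M' : pt) : Prop :=
  match n with
  | O => M' = M
  | S k => exists M1, outer_T p M M1 /\ outer_T_iter p k M1 M'
  end.

Definition periodic_pts (p : R -> R) (n : nat) (M : pt) : Prop :=
  exterior p M /\ outer_T_iter p n M M.

Definition dist2 (X Y : pt) : R :=
  sqrt ((fst X - fst Y) ^ 2 + (snd X - snd Y) ^ 2).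

Definition empty_interior (S : pt -> Prop) : Prop :=
  ~ exists (c : pt) (eps : R), 0 < eps /\ forall X, dist2 X c < eps -> S X.

(* Main.v *)
(* The circle touching L(a) at gamma(a) from outside and tangent to L(b) has a
   radius r(a,b), and T sends (a1,a2) to (a2,a3) with r(a2,a1) = r(a2,a3).
   The twist property is that, for |b - a| < PI, r(a,b) increases strictly with
   |b - a|, in each of its two arguments.

   Move a periodic point along L(a1), so that a1 is fixed and a2 increases.
   The equation r(a2,a1) = r(a2,a3) forces a3 to increase, and the equation at
   the contact point of L(a1) forces the last angle an to decrease. For n = 3
   these two contradict each other. For n = 4 they contradict the equation
   r(a4,a3) = r(a4,a1 + 2 PI): its left side decreases, its right side increases.
   So two points of the same L(a1) are never both periodic. *)

Require Import Defs.
From Stdlib Require Import Reals Lra Lia ZArith.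
From Coquelicot Require Import Coquelicot.
Open Scope R_scope.

(** * Billiard steps in terms of angles *)

Definition gap (p : R -> R) (a b : R) : R :=
  p b - p a * cos (b - a) - Derive p a * sin (b - a).

(** The center [gamma(a) + r n(a)] has signed distance [r cos (b - a) - gap p a b] to [L(b)];
    setting this equal to [- r], with the center on the oval's side of [L(b)], and solving for [r]
    gives the quotient. *)
Definition circ_radius (p : R -> R) (a b : R) : R :=
  gap p a b / (1 + cos (b - a)).

Definition tangent_pair (p : R -> R) (M : pt) (a b : R) : Prop :=
  a < b < a + PI /\ tline p a M /\ tline p b M.

(** Angles are real numbers rather than classes modulo [2 PI], so that orbits can be compared by
    order. *)
Definition billiard_step (p : R -> R) (a1 a2 a3 : R) : Prop :=
  a1 < a2 < a1 + PI /\ a2 < a3 < a2 + PI /\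
  circ_radius p a2 a1 = circ_radius p a2 a3.

(** * Monotonicity and periodicity tools *)

Lemma incr_of_is_derive (f df : R -> R) (a b : R) :
  a < b ->
  (forall x, a <= x <= b -> is_derive f x (df x)) ->
  (forall x, a < x < b -> 0 < df x) ->
  f a < f b.
Proof.
  intros ab Hf Hpos.
  destruct (MVT_cor2 f df a b ab) as [c [E Hc]].
  - intros x Hx. apply is_derive_Reals. now apply Hf.
  - specialize (Hpos c Hc). nra.
Qed.

Lemma decr_of_is_derive (f df : R -> R) (a b : R) :
  a < b ->
  (forall x, a <= x <= b -> is_derive f x (df x)) ->
  (forall x, a < x < b -> df x < 0) ->
  f b < f a.
Proof.
  intros ab Hf Hneg.
  destruct (MVT_cor2 f df a b ab) as [c [E Hc]].
  - intros x Hx. apply is_derive_Reals. now apply Hf.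
  - specialize (Hneg c Hc). nra.
Qed.

Lemma periodic_Z (f : R -> R) (T : R) :
  (forall x, f (x + T) = f x) -> forall (k : Z) x, f (x + T * IZR k) = f x.
Proof.
  intros Hf.
  assert (HN : forall (n : nat) x, f (x + T * INR n) = f x).
  { induction n as [|n IH]; intros x.
    - simpl. f_equal. ring.
    - rewrite S_INR. rewrite <- (IH x), <- (Hf (x + T * INR n)). f_equal. ring. }
  intros k x. destruct (Z_le_gt_dec 0 k) as [Hk|Hk].
  - rewrite <- (Z2Nat.id k Hk), <- INR_IZR_INZ. apply HN.
  - rewrite <- (HN (Z.to_nat (- k))). f_equal.
    rewrite INR_IZR_INZ, Z2Nat.id, opp_IZR by lia. ring.
Qed.

Lemma Derive_periodic (f : R -> R) (T : R) :
  (forall x, f (x + T) = f x) -> forall x, Derive f (x + T) = Derive f x.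
Proof.
  intros Hf x. unfold Derive. f_equal. apply Lim_ext. intros h.
  replace (x + T + h) with (x + h + T) by ring. now rewrite !Hf.
Qed.

Lemma cos_pos_near (x : R) : - PI < x < PI -> 0 < 1 + cos x.
Proof.
  intros Hx. assert (H : cos x = 2 * cos (x / 2) * cos (x / 2) - 1).
  { rewrite <- cos_2a_cos. f_equal. field. }
  assert (0 < cos (x / 2)) by (apply cos_gt_0; lra). nra.
Qed.

(** * Derivative and positivity of the gap *)

Lemma support_derive1 (p : R -> R) (x : R) :
  is_support_fn p -> is_derive p x (Derive p x).
Proof. intros [H _]. apply Derive_correct. exact (H 0%nat x). Qed.

Lemma support_derive2 (p : R -> R) (x : R) :
  is_support_fn p -> is_derive (Derive p) x (Derive_n p 2 x).
Proof. intros [H _]. apply Derive_correct. exact (H 1%nat x). Qed.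

(* [gap p a b] is [p b - gamma(a).n(b)], and the derivative of
   [gamma(x).n(b)] in [x] is the curvature radius times [sin (b - x)]. *)
Lemma gap_is_derive_l (p : R -> R) (b x : R) :
  is_support_fn p ->
  is_derive (fun x => gap p x b) x (- (p x + Derive_n p 2 x) * sin (b - x)).
Proof.
  intros Hp. unfold gap.
  pose proof (support_derive1 p x Hp) as H1.
  pose proof (support_derive2 p x Hp) as H2.
  auto_derive.
  - repeat split; eexists; eassumption.
  - change (Derive (fun x => Derive p x) x) with (Derive_n p 2 x).
    change (Derive (fun x => p x) x) with (Derive p x). unfold Rminus. ring.
Qed.

Lemma gap_diag (p : R -> R) (a : R) : gap p a a = 0.
Proof. unfold gap. rewrite Rminus_diag, cos_0, sin_0. ring. Qed.

(** As the contact angle moves from [a] to [b], the gap decreases strictly to its value 0 on the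
    diagonal, from either side. *)
Lemma gap_pos (p : R -> R) (a b : R) :
  is_support_fn p -> a <> b -> - PI < b - a < PI -> 0 < gap p a b.
Proof.
  intros Hp Hab Hd. rewrite <- (gap_diag p b).
  assert (Hrho : forall x, 0 < p x + Derive_n p 2 x) by (intros; apply Hp).
  destruct (Rlt_le_dec a b) as [Hlt|Hge].
  - apply (decr_of_is_derive (fun x => gap p x b)
             (fun x => - (p x + Derive_n p 2 x) * sin (b - x))); auto.
    + intros; now apply gap_is_derive_l.
    + intros x Hx. specialize (Hrho x).
      assert (0 < sin (b - x)) by (apply sin_gt_0; lra). nra.
  - apply (incr_of_is_derive (fun x => gap p x b)
             (fun x => - (p x + Derive_n p 2 x) * sin (b - x))); [lra| |].
    + intros; now apply gap_is_derive_l.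
    + intros x Hx. specialize (Hrho x).
      assert (0 < sin (x - b)) by (apply sin_gt_0; lra).
      replace (sin (b - x)) with (- sin (x - b)) by (rewrite <- sin_neg; f_equal; ring).
      nra.
Qed.

(** * The twist property of the circle radius *)

(** The quotient rule folds [gap] back into [circ_radius]. The bracket is the curvature radius of
    the oval plus the radius of the circle, so the sign is that of [sin (x - b)]. *)
Lemma circ_radius_is_derive_l (p : R -> R) (b x : R) :
  is_support_fn p -> - PI < b - x < PI ->
  is_derive (fun x => circ_radius p x b) x
    (- sin (b - x) * (p x + Derive_n p 2 x + circ_radius p x b) / (1 + cos (b - x))).
Proof.
  intros Hp Hd. pose proof (cos_pos_near _ Hd) as Hc.
  pose proof (support_derive1 p x Hp) as H1.
  pose proof (support_derive2 p x Hp) as H2.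
  unfold circ_radius, gap. auto_derive.
  - replace (b + - x) with (b - x) by ring.
    repeat split; try (eexists; eassumption). lra.
  - change (Derive (fun x => Derive p x) x) with (Derive_n p 2 x).
    change (Derive (fun x => p x) x) with (Derive p x).
    unfold Rminus in *. field. lra.
Qed.

(* The inner product of [gamma(b) - gamma(a)] with the tangent direction at
   the mid-angle; along the arc this direction makes an angle below [PI/2]
   with the velocity. *)
Lemma chord_midtangent_pos (p : R -> R) (a b : R) :
  is_support_fn p -> a < b < a + PI ->
  0 < (Derive p b - Derive p a) * cos ((b - a) / 2) + (p a + p b) * sin ((b - a) / 2).
Proof.
  intros Hp Hab. set (m := (a + b) / 2).
  assert (H : Derive p a * cos (a - m) + p a * sin (a - m)
              < Derive p b * cos (b - m) + p b * sin (b - m)).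
  { apply (incr_of_is_derive (fun x => Derive p x * cos (x - m) + p x * sin (x - m))
             (fun x => (p x + Derive_n p 2 x) * cos (x - m))); [lra| |].
    - intros x _.
      pose proof (support_derive1 p x Hp) as H1.
      pose proof (support_derive2 p x Hp) as H2.
      auto_derive.
      + repeat split; eexists; eassumption.
      + change (Derive (fun x => Derive p x) x) with (Derive_n p 2 x).
        change (Derive (fun x => p x) x) with (Derive p x). unfold Rminus. ring.
    - intros x Hx. apply Rmult_lt_0_compat; [apply Hp|].
      apply cos_gt_0; unfold m; lra. }
  replace (a - m) with (- ((b - a) / 2)) in H by (unfold m; field).
  replace (b - m) with ((b - a) / 2) in H by (unfold m; field).
  rewrite cos_neg, sin_neg in H. lra.
Qed.

(** The half-angle form isolates the factor whose sign [chord_midtangent_pos] determines. *)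
Lemma circ_radius_is_derive_r (p : R -> R) (a x : R) :
  is_support_fn p -> - PI < x - a < PI ->
  is_derive (fun x => circ_radius p a x) x
    (2 * cos ((x - a) / 2) *
     ((Derive p x - Derive p a) * cos ((x - a) / 2) + (p a + p x) * sin ((x - a) / 2))
     / (1 + cos (x - a)) ^ 2).
Proof.
  intros Hp Hd. pose proof (cos_pos_near _ Hd) as Hc.
  pose proof (support_derive1 p x Hp) as H1.
  set (h := (x - a) / 2).
  assert (Ec : cos (x - a) = 2 * cos h * cos h - 1)
    by (rewrite <- cos_2a_cos; f_equal; unfold h; field).
  assert (Es : sin (x - a) = 2 * sin h * cos h)
    by (rewrite <- sin_2a; f_equal; unfold h; field).
  assert (E1 : sin h * sin h = 1 - cos h * cos h)
    by (pose proof (sin2_cos2 h) as E; unfold Rsqr in E; lra).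
  unfold circ_radius, gap. auto_derive.
  - replace (x + - a) with (x - a) by ring.
    repeat split; try (eexists; eassumption). lra.
  - change (Derive (fun x => p x) x) with (Derive p x).
    replace (x + - a) with (x - a) by ring.
    rewrite Ec in Hc |- *. rewrite Es.
    assert (cos h <> 0) by (intros E; rewrite E in Hc; lra).
    field_simplify_eq; [|lra].
    ring_simplify.
    replace (sin h ^ 2) with (1 - cos h * cos h) by (rewrite <- E1; ring).
    ring.
Qed.

Lemma circ_radius_incr_r (p : R -> R) (a b b' : R) :
  is_support_fn p -> a < b < b' -> b' < a + PI ->
  circ_radius p a b < circ_radius p a b'.
Proof.
  intros Hp Hb Hb'.
  eapply incr_of_is_derive; [lra| |].
  - intros x Hx. apply circ_radius_is_derive_r; [assumption|lra].
  - intros x Hx. cbv beta.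
    assert (0 < 1 + cos (x - a)) by (apply cos_pos_near; lra).
    assert (0 < cos ((x - a) / 2)) by (apply cos_gt_0; lra).
    pose proof (chord_midtangent_pos p a x Hp ltac:(lra)).
    apply Rdiv_lt_0_compat; [|nra]. apply Rmult_lt_0_compat; lra.
Qed.

Lemma circ_radius_decr_r (p : R -> R) (a b b' : R) :
  is_support_fn p -> b < b' < a -> a - PI < b ->
  circ_radius p a b' < circ_radius p a b.
Proof.
  intros Hp Hb Hb'.
  eapply decr_of_is_derive; [lra| |].
  - intros x Hx. apply circ_radius_is_derive_r; [assumption|lra].
  - intros x Hx. cbv beta.
    assert (0 < 1 + cos (x - a)) by (apply cos_pos_near; lra).
    assert (0 < cos ((x - a) / 2)) by (apply cos_gt_0; lra).
    (* Here [x] precedes [a], so the chord runs from [x] to [a]; by parity of [cos] and [sin] the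
       factor in the derivative is negative. *)
    pose proof (chord_midtangent_pos p x a Hp ltac:(lra)) as H1.
    replace ((a - x) / 2) with (- ((x - a) / 2)) in H1 by field.
    rewrite cos_neg, sin_neg in H1.
    apply Ropp_lt_cancel. rewrite Ropp_0, <- Rdiv_opp_l.
    apply Rdiv_lt_0_compat; nra.
Qed.

Lemma circ_radius_pos (p : R -> R) (a b : R) :
  is_support_fn p -> a <> b -> - PI < b - a < PI -> 0 < circ_radius p a b.
Proof.
  intros Hp Hab Hd. apply Rdiv_lt_0_compat; [now apply gap_pos | now apply cos_pos_near].
Qed.

Lemma circ_radius_decr_l (p : R -> R) (a a' b : R) :
  is_support_fn p -> a < a' < b -> b < a + PI ->
  circ_radius p a' b < circ_radius p a b.
Proof.
  intros Hp Ha Hb.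
  apply (decr_of_is_derive (fun x => circ_radius p x b) (fun x =>
    - sin (b - x) * (p x + Derive_n p 2 x + circ_radius p x b) / (1 + cos (b - x))));
    [lra| |].
  - intros x Hx. apply circ_radius_is_derive_l; [assumption|lra].
  - intros x Hx.
    assert (0 < 1 + cos (b - x)) by (apply cos_pos_near; lra).
    assert (0 < sin (b - x)) by (apply sin_gt_0; lra).
    assert (0 < p x + Derive_n p 2 x) by apply Hp.
    pose proof (circ_radius_pos p x b Hp ltac:(lra) ltac:(lra)).
    apply Ropp_lt_cancel. rewrite Ropp_0, <- Rdiv_opp_l.
    apply Rdiv_lt_0_compat; nra.
Qed.

Lemma circ_radius_incr_l (p : R -> R) (a a' b : R) :
  is_support_fn p -> b < a < a' -> a' < b + PI ->
  circ_radius p a b < circ_radius p a' b.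
Proof.
  intros Hp Ha Hb.
  apply (incr_of_is_derive (fun x => circ_radius p x b) (fun x =>
    - sin (b - x) * (p x + Derive_n p 2 x + circ_radius p x b) / (1 + cos (b - x))));
    [lra| |].
  - intros x Hx. apply circ_radius_is_derive_l; [assumption|lra].
  - intros x Hx.
    assert (0 < 1 + cos (b - x)) by (apply cos_pos_near; lra).
    assert (0 < sin (x - b)) by (apply sin_gt_0; lra).
    replace (- sin (b - x)) with (sin (x - b)) by (rewrite <- sin_neg; f_equal; ring).
    assert (0 < p x + Derive_n p 2 x) by apply Hp.
    pose proof (circ_radius_pos p x b Hp ltac:(lra) ltac:(lra)).
    apply Rdiv_lt_0_compat; nra.
Qed.

(** * The two tangent lines through a point, up to full turns *)

Lemma support_periodic_Z (p : R -> R) (k : Z) (x : R) :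
  is_support_fn p -> p (x + 2 * PI * IZR k) = p x.
Proof. intros (_ & H & _). exact (periodic_Z p _ H k x). Qed.

Lemma Derive_support_periodic_Z (p : R -> R) (k : Z) (x : R) :
  is_support_fn p -> Derive p (x + 2 * PI * IZR k) = Derive p x.
Proof. intros (_ & H & _). exact (periodic_Z _ _ (Derive_periodic p _ H) k x). Qed.

Lemma nrm_periodic_Z (k : Z) (x : R) : nrm (x + 2 * PI * IZR k) = nrm x.
Proof.
  unfold nrm. f_equal.
  - apply (periodic_Z cos). intros y. rewrite cos_plus, cos_2PI, sin_2PI. ring.
  - apply (periodic_Z sin). intros y. rewrite sin_plus, cos_2PI, sin_2PI. ring.
Qed.

Lemma tline_periodic_Z (p : R -> R) (M : pt) (k : Z) (x : R) :
  is_support_fn p -> tline p (x + 2 * PI * IZR k) M <-> tline p x M.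
Proof.
  intros Hp. unfold tline. now rewrite nrm_periodic_Z, support_periodic_Z.
Qed.

Lemma circ_radius_periodic_Z (p : R -> R) (k : Z) (a b : R) :
  is_support_fn p ->
  circ_radius p (a + 2 * PI * IZR k) (b + 2 * PI * IZR k) = circ_radius p a b.
Proof.
  intros Hp. unfold circ_radius, gap.
  rewrite !support_periodic_Z, Derive_support_periodic_Z by assumption.
  replace (b + 2 * PI * IZR k - (a + 2 * PI * IZR k)) with (b - a) by ring.
  reflexivity.
Qed.

(* The derivative at [x] of [p x - M.n(x)], the signed distance from [M] to
   the tangent line with normal angle [x]. *)
Definition slope (p : R -> R) (M : pt) (x : R) : R :=
  Derive p x + fst M * sin x - snd M * cos x.

Lemma slope_periodic_Z (p : R -> R) (M : pt) (k : Z) (x : R) :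
  is_support_fn p -> slope p M (x + 2 * PI * IZR k) = slope p M x.
Proof.
  intros Hp. unfold slope. rewrite Derive_support_periodic_Z by assumption.
  pose proof (nrm_periodic_Z k x) as E. unfold nrm in E. now injection E as -> ->.
Qed.

(** On [L(a)], [slope p M a] is the signed displacement from [M] to [gamma(a)], and the unit tangent
    there has component [sin (b - a)] along [n(b)]. *)
Lemma gap_of_tangents (p : R -> R) (M : pt) (a b : R) :
  tline p a M -> tline p b M -> gap p a b = - slope p M a * sin (b - a).
Proof.
  unfold tline, dot, nrm, gap, slope. simpl. intros Ha Hb.
  rewrite <- Ha, <- Hb, cos_minus, sin_minus.
  pose proof (sin2_cos2 a) as E. unfold Rsqr in E.
  replace (fst M * cos b + snd M * sin b) with
    ((fst M * cos b + snd M * sin b) * (sin a * sin a + cos a * cos a)) by (rewrite E; ring).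
  ring.
Qed.

Lemma tangent_pair_slopes (p : R -> R) (M : pt) (a b : R) :
  is_support_fn p -> tangent_pair p M a b -> slope p M a < 0 < slope p M b.
Proof.
  intros Hp (Hab & Ha & Hb).
  pose proof (gap_pos p a b Hp ltac:(lra) ltac:(lra)) as G1.
  pose proof (gap_pos p b a Hp ltac:(lra) ltac:(lra)) as G2.
  rewrite (gap_of_tangents p M) in G1, G2 by assumption.
  replace (sin (a - b)) with (- sin (b - a)) in G2 by (rewrite <- sin_neg; f_equal; ring).
  assert (0 < sin (b - a)) by (apply sin_gt_0; lra). split; nra.
Qed.

Lemma congruent_representative (a x : R) :
  exists k : Z, a <= x + 2 * PI * IZR k < a + 2 * PI.
Proof.
  pose proof PI_RGT_0 as HPI.
  set (r := (a - x) / (2 * PI)).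
  assert (E : a = x + 2 * PI * r) by (unfold r; field; lra).
  destruct (archimed (- r)) as [H1 H2].
  (* This is the ceiling of [r], since [up (- r) - 1] is the floor of [- r]. *)
  exists (1 - up (- r))%Z. rewrite minus_IZR.
  generalize dependent (IZR (up (- r))). intros; nra.
Qed.

(* The sign of [slope] tells apart the two tangent lines through an exterior point. *)
Lemma tangent_pair_first_unique (p : R -> R) (M : pt) (a b x : R) :
  is_support_fn p -> tangent_pair p M a b -> tline p x M -> slope p M x < 0 ->
  exists k : Z, x = a + 2 * PI * IZR k.
Proof.
  intros Hp Hab Hx Hs. pose proof PI_RGT_0 as HPI.
  destruct (congruent_representative a x) as [k Hk].
  set (y := x + 2 * PI * IZR k) in *.
  assert (Hy : tline p y M) by now apply tline_periodic_Z.
  assert (Hsy : slope p M y < 0) by (unfold y; now rewrite slope_periodic_Z).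
  pose proof (tangent_pair_slopes p M a b Hp Hab) as Hsab.
  destruct Hab as (Hab & Ha & Hb).
  destruct (Req_dec y a) as [E|Nya].
  { exists (- k)%Z. rewrite opp_IZR. unfold y in E. lra. }
  exfalso.
  (* In each case a tangent pair has the wrong slope sign: [(a, y)]; [(b, y)] when [L(y)] is
     parallel to [L(a)]; or [(y, a + 2 PI)]. *)
  destruct (Rlt_le_dec y (a + PI)) as [H1|H1].
  - destruct (tangent_pair_slopes p M a y Hp); [repeat split; auto; lra | lra].
  - assert (HT : tline p (a + 2 * PI * IZR 1) M) by now apply tline_periodic_Z.
    destruct (Req_dec y (a + PI)) as [E|N].
    + destruct (tangent_pair_slopes p M b y Hp); [repeat split; auto; lra | lra].
    + destruct (tangent_pair_slopes p M y (a + 2 * PI * IZR 1) Hp) as [_ H2];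
        [repeat split; auto; lra|].
      rewrite slope_periodic_Z in H2 by assumption. lra.
Qed.

(** Once the first angles are matched, distinct second angles would differ by less than [PI] and
    form a tangent pair, making the earlier slope negative. *)
Lemma tangent_pair_unique (p : R -> R) (M : pt) (a b a' b' : R) :
  is_support_fn p -> tangent_pair p M a b -> tangent_pair p M a' b' ->
  exists k : Z, a' = a + 2 * PI * IZR k /\ b' = b + 2 * PI * IZR k.
Proof.
  intros Hp H H'.
  pose proof (tangent_pair_slopes p M a b Hp H) as Hs.
  pose proof (tangent_pair_slopes p M a' b' Hp H') as Hs'.
  destruct H' as (Hab' & Ha' & Hb').
  destruct (tangent_pair_first_unique p M a b a') as [k Hk]; [auto..|lra|].
  exists k. split; [assumption|].
  set (b'' := b' + 2 * PI * IZR (- k)).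
  assert (Eb : b' = b'' + 2 * PI * IZR k) by (unfold b''; rewrite opp_IZR; ring).
  assert (Hb'' : tline p b'' M) by now apply tline_periodic_Z.
  assert (Hs'' : 0 < slope p M b'') by (unfold b''; now rewrite slope_periodic_Z).
  destruct H as (Hab & Ha & Hb).
  destruct (Rtotal_order b b'') as [L|[E|L]].
  - destruct (tangent_pair_slopes p M b b'' Hp); [repeat split; auto; lra | lra].
  - now rewrite E.
  - destruct (tangent_pair_slopes p M b'' b Hp); [repeat split; auto; lra | lra].
Qed.

(** * From the geometric map to closed sequences of angles *)

Lemma outer_T_step (p : R -> R) (M M' : pt) (a1 a2 : R) :
  is_support_fn p -> outer_T p M M' -> tangent_pair p M a1 a2 ->
  exists a3, billiard_step p a1 a2 a3 /\ tangent_pair p M' a2 a3.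
Proof.
  intros Hp (b1 & b2 & b3 & r & C & Hb12 & Hb1 & Hb2 & Hr & HC & HK1 & Hb23 & _ & _ &
             HK3 & Hside & HM2 & HM3) H.
  destruct (tangent_pair_unique p M b1 b2 a1 a2) as (k & -> & ->);
    [auto | repeat split; tauto | auto |].
  exists (b3 + 2 * PI * IZR k).
  assert (HCn : forall x, dot C (nrm x) - p x = r * cos (x - b2) - gap p b2 x).
  { intros x. subst C. unfold dot, nrm, gap, gam. simpl.
    rewrite cos_minus, sin_minus. ring. }
  rewrite HCn in HK1, HK3.
  assert (Hside' : r * cos (b3 - b2) - gap p b2 b3 < 0) by (rewrite <- HCn; lra).
  pose proof (cos_pos_near (b1 - b2) ltac:(lra)) as Hc1.
  pose proof (cos_pos_near (b3 - b2) ltac:(lra)) as Hc3.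
  pose proof (gap_pos p b2 b1 Hp ltac:(lra) ltac:(lra)) as Hg.
  pose proof (COS_bound (b1 - b2)) as Hcb.
  (* At [L(b1)] the other sign of the absolute value would force [gap p b2 b1 <= 0]; at [L(b3)] the
     side condition selects the sign. *)
  assert (E : circ_radius p b2 b1 = circ_radius p b2 b3).
  { transitivity r; [|symmetry]; unfold circ_radius.
    - unfold Rabs in HK1. destruct Rcase_abs in HK1.
      + replace (gap p b2 b1) with (r * (1 + cos (b1 - b2))) by lra. field. lra.
      + nra.
    - rewrite Rabs_left in HK3 by assumption.
      replace (gap p b2 b3) with (r * (1 + cos (b3 - b2))) by lra. field. lra. }
  split.
  - split; [lra|]. split; [lra|]. now rewrite !circ_radius_periodic_Z.
  - split; [lra|]. now rewrite !tline_periodic_Z.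
Qed.

Lemma outer_T_tangent_pair (p : R -> R) (M M' : pt) :
  outer_T p M M' -> exists a b, tangent_pair p M a b.
Proof.
  intros (a & b & _ & _ & _ & H & Ha & Hb & _). exists a, b. repeat split; tauto.
Qed.

(** Three or four increments in [(0, PI)] total less than [4 PI], so a closed orbit winds around
    exactly once. *)
Lemma closing_shift (p : R -> R) (M : pt) (a b a' b' : R) :
  is_support_fn p -> tangent_pair p M a b -> tangent_pair p M a' b' ->
  a < a' < a + 4 * PI -> a' = a + 2 * PI /\ b' = b + 2 * PI.
Proof.
  intros Hp H H' Ha. pose proof PI_RGT_0 as HPI.
  destruct (tangent_pair_unique p M a b a' b' Hp H H') as (k & -> & ->).
  assert (0 < IZR k < 2) as [K1 K2] by (split; nra).
  apply lt_IZR in K1. apply lt_IZR in K2. assert (k = 1%Z) as -> by lia. lra.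
Qed.

Lemma periodic3_angles (p : R -> R) (M : pt) (a1 a2 : R) :
  is_support_fn p -> outer_T_iter p 3 M M -> tangent_pair p M a1 a2 ->
  exists a3, billiard_step p a1 a2 a3 /\ billiard_step p a2 a3 (a1 + 2 * PI) /\
    billiard_step p a3 (a1 + 2 * PI) (a2 + 2 * PI).
Proof.
  intros Hp (M1 & T1 & M2 & T2 & M3 & T3 & HM) H. simpl in HM. subst M3.
  destruct (outer_T_step p M M1 a1 a2 Hp T1 H) as (a3 & S1 & H1).
  destruct (outer_T_step p M1 M2 a2 a3 Hp T2 H1) as (a4 & S2 & H2).
  destruct (outer_T_step p M2 M a3 a4 Hp T3 H2) as (a5 & S3 & H3).
  destruct (closing_shift p M a1 a2 a4 a5 Hp H H3) as [-> ->];
    [unfold billiard_step in *; lra|].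
  now exists a3.
Qed.

Lemma periodic4_angles (p : R -> R) (M : pt) (a1 a2 : R) :
  is_support_fn p -> outer_T_iter p 4 M M -> tangent_pair p M a1 a2 ->
  exists a3 a4, billiard_step p a1 a2 a3 /\ billiard_step p a2 a3 a4 /\
    billiard_step p a3 a4 (a1 + 2 * PI) /\
    billiard_step p a4 (a1 + 2 * PI) (a2 + 2 * PI).
Proof.
  intros Hp (M1 & T1 & M2 & T2 & M3 & T3 & M4 & T4 & HM) H. simpl in HM. subst M4.
  destruct (outer_T_step p M M1 a1 a2 Hp T1 H) as (a3 & S1 & H1).
  destruct (outer_T_step p M1 M2 a2 a3 Hp T2 H1) as (a4 & S2 & H2).
  destruct (outer_T_step p M2 M3 a3 a4 Hp T3 H2) as (a5 & S3 & H3).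
  destruct (outer_T_step p M3 M a4 a5 Hp T4 H3) as (a6 & S4 & H4).
  destruct (closing_shift p M a1 a2 a5 a6 Hp H H4) as [-> ->];
    [unfold billiard_step in *; lra|].
  now exists a3, a4.
Qed.

(** * Comparison of orbits sharing a tangent line *)

(** If [b3 <= a3], then [r(a2,a1) < r(b2,a1) = r(b2,b3) <= r(b2,a3) < r(a2,a3)], against
    [r(a2,a1) = r(a2,a3)]. *)
Lemma billiard_step_incr (p : R -> R) (a1 a2 a3 b2 b3 : R) :
  is_support_fn p -> billiard_step p a1 a2 a3 -> billiard_step p a1 b2 b3 ->
  a2 < b2 -> a3 < b3.
Proof.
  intros Hp (A1 & A2 & EA) (B1 & B2 & EB) L.
  apply Rnot_le_lt. intros N.
  pose proof (circ_radius_incr_l p a2 b2 a1 Hp ltac:(lra) ltac:(lra)).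
  pose proof (circ_radius_decr_l p a2 b2 a3 Hp ltac:(lra) ltac:(lra)).
  destruct N as [N|N].
  - pose proof (circ_radius_incr_r p b2 b3 a3 Hp ltac:(lra) ltac:(lra)). lra.
  - subst b3. lra.
Qed.

(** With the contact point on [L(a1)] fixed, a larger last angle means a larger circle, whose other
    tangent line lies further back. *)
Lemma billiard_step_decr (p : R -> R) (a0 a1 a2 b0 b2 : R) :
  is_support_fn p -> billiard_step p a0 a1 a2 -> billiard_step p b0 a1 b2 ->
  a2 < b2 -> b0 < a0.
Proof.
  intros Hp (A1 & A2 & EA) (B1 & B2 & EB) L.
  apply Rnot_le_lt. intros N.
  pose proof (circ_radius_incr_r p a1 a2 b2 Hp ltac:(lra) ltac:(lra)).
  destruct N as [N|N].
  - pose proof (circ_radius_decr_r p a1 a0 b0 Hp ltac:(lra) ltac:(lra)). lra.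
  - subst b0. lra.
Qed.

Lemma periodic3_rigid (p : R -> R) (M M' : pt) (a1 a2 b2 : R) :
  is_support_fn p -> outer_T_iter p 3 M M -> outer_T_iter p 3 M' M' ->
  tangent_pair p M a1 a2 -> tangent_pair p M' a1 b2 -> ~ a2 < b2.
Proof.
  intros Hp T T' H H' L.
  destruct (periodic3_angles p M a1 a2 Hp T H) as (a3 & A1 & _ & A3).
  destruct (periodic3_angles p M' a1 b2 Hp T' H') as (b3 & B1 & _ & B3).
  pose proof (billiard_step_incr p a1 a2 a3 b2 b3 Hp A1 B1 L).
  pose proof (billiard_step_decr p _ _ _ _ _ Hp A3 B3 ltac:(lra)). lra.
Qed.

Lemma periodic4_rigid (p : R -> R) (M M' : pt) (a1 a2 b2 : R) :
  is_support_fn p -> outer_T_iter p 4 M M -> outer_T_iter p 4 M' M' ->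
  tangent_pair p M a1 a2 -> tangent_pair p M' a1 b2 -> ~ a2 < b2.
Proof.
  intros Hp T T' H H' L.
  destruct (periodic4_angles p M a1 a2 Hp T H) as (a3 & a4 & A1 & _ & A3 & A4).
  destruct (periodic4_angles p M' a1 b2 Hp T' H') as (b3 & b4 & B1 & _ & B3 & B4).
  pose proof (billiard_step_incr p a1 a2 a3 b2 b3 Hp A1 B1 L).
  pose proof (billiard_step_decr p _ _ _ _ _ Hp A4 B4 ltac:(lra)).
  destruct A3 as (A31 & A32 & EA), B3 as (B31 & B32 & EB).
  (* The contradictory cycle is [r(b4,b3) < r(b4,a3) < r(a4,a3) = r(a4,a1 + 2 PI) < r(b4,a1 + 2 PI)
     = r(b4,b3)]. *)
  pose proof (circ_radius_decr_r p b4 a3 b3 Hp ltac:(lra) ltac:(lra)).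
  pose proof (circ_radius_incr_l p b4 a4 a3 Hp ltac:(lra) ltac:(lra)).
  pose proof (circ_radius_decr_l p b4 a4 (a1 + 2 * PI) Hp ltac:(lra) ltac:(lra)).
  lra.
Qed.

(* The point [c] is moved along [L(a)] away from the contact point, which keeps
   [L(a)] as the first of the two tangent lines. *)
Lemma empty_interior_of_rigid (p : R -> R) (S : pt -> Prop) :
  is_support_fn p ->
  (forall M, S M -> exists a b, tangent_pair p M a b) ->
  (forall M M' a1 a2 b2, S M -> S M' ->
     tangent_pair p M a1 a2 -> tangent_pair p M' a1 b2 -> ~ a2 < b2) ->
  empty_interior S.
Proof.
  intros Hp Hpair Hrigid (c & eps & Heps & HS).
  assert (Sc : S c).
  { apply HS. unfold dist2. rewrite !Rminus_diag.
    replace (0 ^ 2 + 0 ^ 2) with 0 by ring. now rewrite sqrt_0. }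
  destruct (Hpair c Sc) as (a & b & Hab).
  set (M := (fst c - eps / 2 * sin a, snd c + eps / 2 * cos a) : pt).
  pose proof (sin2_cos2 a) as Ea. unfold Rsqr in Ea.
  assert (SM : S M).
  { apply HS. unfold dist2, M. simpl fst. simpl snd.
    replace (_ + _) with ((eps / 2) ^ 2 * (sin a * sin a + cos a * cos a)) by ring.
    rewrite Ea, Rmult_1_r, sqrt_pow2; lra. }
  destruct (Hpair M SM) as (a' & b' & Hab').
  pose proof (tangent_pair_slopes p c a b Hp Hab) as [Hs _].
  assert (HaM : tline p a M).
  { destruct Hab as (_ & Ha & _). revert Ha. unfold tline, dot, M, nrm. simpl. lra. }
  assert (HsM : slope p M a < 0).
  { assert (slope p M a = slope p c a - eps / 2 * (sin a * sin a + cos a * cos a))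
      by (unfold slope, M; simpl; ring).
    rewrite Ea in H. lra. }
  (* The negative slope makes [L(a)] the first line through [M]; shifting the pair by full turns
     makes its first angle exactly [a]. *)
  destruct (tangent_pair_first_unique p M a' b' a Hp Hab' HaM HsM) as [k Hk].
  set (d := b' + 2 * PI * IZR k).
  assert (Had : tangent_pair p M a d).
  { destruct Hab' as (H & _ & Hb). split; [unfold d; lra|].
    split; [assumption|]. now apply tline_periodic_Z. }
  destruct (Rtotal_order b d) as [L|[E|L]].
  - exact (Hrigid c M a b d Sc SM Hab Had L).
  - clearbody d. subst d.
    destruct Hab as (Hlt & _ & Hb), Had as (_ & _ & Hd).
    (* Otherwise [c] and [M] would both lie on [L(b)], although the displacement along [L(a)] is
       transversal to it. *)
    assert (E : eps / 2 * sin (b - a) = 0).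
    { rewrite sin_minus. revert Hb Hd. unfold tline, dot, M, nrm. simpl. lra. }
    assert (0 < sin (b - a)) by (apply sin_gt_0; lra). nra.
  - exact (Hrigid M c a d b SM Sc Had Hab L).
Qed.

Theorem mainTheorem6 (p : R -> R) :
  is_support_fn p ->
  empty_interior (periodic_pts p 3) /\ empty_interior (periodic_pts p 4).
Proof.
  intros Hp. split; apply (empty_interior_of_rigid p); try assumption.
  - intros M (_ & M1 & T & _). exact (outer_T_tangent_pair p M M1 T).
  - intros M M' a1 a2 b2 (_ & T) (_ & T'). now apply periodic3_rigid.
  - intros M (_ & M1 & T & _). exact (outer_T_tangent_pair p M M1 T).
  - intros M M' a1 a2 b2 (_ & T) (_ & T'). now apply periodic4_rigid.
Qed.
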